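(* Let $G_0$ be a directed ancestral graph with finite node set $V$ and let $P$ be a joint probability distribution of random variables $(X_v)_{v\in V}$ that is faithful to $G_0$. If $G$ is a directed ancestral graph on $V$ that is Markov equivalent to $G_0$, then $P$ satisfies ordered upward- and downward-stability w.r.t. $G$.
   Context: Graphs. A directed ancestral graph on a finite node set $V$ is a simple graph (at most one edge between two distinct nodes) whose edges are arrows $i\to j$ or arcs $i\leftrightarrow j$, with no directed cycle and with no arc one of whose endpoints is an ancestor of the other. $\mathrm{an}(i)$ is the set of nodes $k\neq i$ with a directed path from $k$ to $i$. A path has no repeated nodes; an inner node of a path is a collider on it if both adjacent path edges have an arrowhead at it, else a non-collider. A path is connecting given $C$ if every collider on it is in $C$ or is an ancestor of a node of $C$ and no non-collider inner node is in $C$. For disjoint $A,B,C$, $A\perp B\mid C$ (separation) means no path between $A$ and $B$ is connecting given $C$. $\mathcal J(G)$ is the set of triples $\langle A,B\mid C\rangle$ with $A\perp B\mid C$ in $G$. $G,H$ are Markov equivalent if $\mathcal J(G)=\mathcal J(H)$. Distributions. $A\perp\!\!\!\perp B\mid C$ means $X_A$ is conditionally independent of $X_B$ given $X_C$ under $P$; $\mathcal J(P)$ is the set of triples $\langle A,B\mid C\rangle$ with $A\perp\!\!\!\perp B\mid C$. $P$ is faithful to $G$ if $\mathcal J(P)=\mathcal J(G)$. Ordered stability. The minimal order of $G$ is the partial order in which $k>i$ iff $k\in\mathrm{an}(i)$. $P$ satisfies, w.r.t. $G$ (i.e. w.r.t. its minimal order): ordered upward-stability if $i\perp\!\!\!\perp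 j\mid C$ implies $i\perp\!\!\!\perp j\mid C\cup\{k\}$ for every $k\in V\setminus\{i,j\}$ with $i<k$ or $j<k$; ordered downward-stability if $i\perp\!\!\!\perp j\mid C$ implies $i\perp\!\!\!\perp j\mid C\setminus\{k\}$ for every $k\in V\setminus\{i,j\}$ with $i\nless k$, $j\nless k$, and $l\nless k$ for every $l\in C\setminus\{k\}$. *)

(* Defs.v *)
From mathcomp Require Import all_boot all_order all_algebra.
From mathcomp Require Import all_classical all_reals all_analysis.

Set Implicit Arguments.
Unset Strict Implicit.
Unset Printing Implicit Defensive.

Definition ancestors (V : finType) (arr : rel V) (i : V) : {set V} :=
  [set k : V | (k != i) && connect arr k i]%SET.

Record directed_ancestral_graph (V : finType) := DirectedAncestralGraph {
  arrow : rel V;  (* arrow i j is i -> j *)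
  arc : rel V;    (* arc i j is i <-> j *)
  arc_sym : symmetric arc;
  arc_irrefl : irreflexive arc;
  at_most_one_edge :
    forall i j : V, i != j -> (arrow i j + arrow j i + arc i j <= 1)%N;
  no_directed_cycle : forall c : seq V, cycle arrow c -> c = [::];
  (* the other endpoint is covered by arc_sym *)
  arc_not_ancestor : forall i j : V, arc i j -> i \notin ancestors arrow j
}.

Section Separation.
Variables (V : finType) (G : directed_ancestral_graph V).
Implicit Types (A B C : {set V}) (i j k : V).

Definition an (i : V) : {set V} := ancestors (arrow G) i.

Definition adjacent : rel V :=
  fun i j => [|| arrow G i j, arrow G j i | arc G i j].

(* There is at most one edge between two nodes, so a path is determined by its
   sequence of nodes. *)
Definition is_path (i : V) (s : seq V) : Prop :=
  path adjacent i s /\ uniq (i :: s).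

Definition arrowhead_at (k i : V) : bool := arrow G i k || arc G i k.

Definition collider (a k b : V) : bool :=
  arrowhead_at k a && arrowhead_at k b.

Definition connecting (C : {set V}) (s : seq V) : Prop :=
  forall (s1 s2 : seq V) (a k b : V), s = s1 ++ [:: a, k, b & s2] ->
    if collider a k b
    then k \in C \/ (exists2 c, c \in C & k \in an c)
    else k \notin C.

Definition separated (A B C : {set V}) : Prop :=
  forall (i : V) (s : seq V), is_path i s -> i \in A -> last i s \in B ->
    ~ connecting C (i :: s).

Definition minimal_order : rel V := fun i k => k \in an i.

End Separation.

Definition disjoint_triple (V : finType) (A B C : {set V}) : bool :=
  [&& [disjoint A & B], [disjoint A & C] & [disjoint B & C]].

Local Open Scope classical_set_scope.

Definition J_graph (V : finType) (G : directed_ancestral_graph V) :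
    set ({set V} * {set V} * {set V}) :=
  [set t | disjoint_triple t.1.1 t.1.2 t.2 /\
           separated G t.1.1 t.1.2 t.2].

Definition Markov_equivalent (V : finType)
    (G H : directed_ancestral_graph V) : Prop :=
  J_graph G = J_graph H.

Section ConditionalIndependence.
Context {R : realType} {d : measure_display} {Omega : measurableType d}.
Variable P : probability Omega R.

(* f is a version of the conditional probability P(S | F), for a
   sub-sigma-algebra F. *)
Definition is_cond_prob (F : set (set Omega)) (S : set Omega)
    (f : Omega -> R) : Prop :=
  [/\ forall Y : set R, measurable Y -> F (f @^-1` Y),
      P.-integrable setT (EFin \o f) &
      forall D : set Omega, F D ->
        (\int[P]_(w in D) (f w)%:E = P (S `&` D))%E].

Definition cond_indep_sigma (F1 F2 F3 : set (set Omega)) : Prop :=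
  forall S1 S2 : set Omega, F1 S1 -> F2 S2 ->
    exists f1 f2 f12 : Omega -> R,
      [/\ is_cond_prob F3 S1 f1, is_cond_prob F3 S2 f2,
          is_cond_prob F3 (S1 `&` S2) f12 &
          {ae P, forall w, f12 w = (f1 w * f2 w)%R}].

Context {V : finType} {dE : V -> measure_display}.
Context {E : forall v : V, measurableType (dE v)}.
Variable X : forall v : V, {RV P >-> E v}.

(* the sigma-algebra generated by X_A = (X_v)_{v in A} *)
Definition sigma_of (A : {set V}) : set (set Omega) :=
  <<s \bigcup_(v in [set` A]) preimage_set_system setT (X v) measurable >>.

Definition cond_indep (A B C : {set V}) : Prop :=
  cond_indep_sigma (sigma_of A) (sigma_of B) (sigma_of C).

Definition J_dist : set ({set V} * {set V} * {set V}) :=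
  [set t | disjoint_triple t.1.1 t.1.2 t.2 /\
           cond_indep t.1.1 t.1.2 t.2].

Definition faithful (G : directed_ancestral_graph V) : Prop :=
  J_dist = J_graph G.

Definition ordered_upward_stable (lt : rel V) : Prop :=
  forall (i j : V) (C : {set V}), i != j -> i \notin C -> j \notin C ->
    cond_indep [set i]%SET [set j]%SET C ->
    forall k : V, k != i -> k != j -> lt i k || lt j k ->
      cond_indep [set i]%SET [set j]%SET (k |: C)%SET.

Definition ordered_downward_stable (lt : rel V) : Prop :=
  forall (i j : V) (C : {set V}), i != j -> i \notin C -> j \notin C ->
    cond_indep [set i]%SET [set j]%SET C ->
    forall k : V, k != i -> k != j -> ~~ lt i k -> ~~ lt j k ->
      (forall l : V, l \in (C :\ k)%SET -> ~~ lt l k) ->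
      cond_indep [set i]%SET [set j]%SET (C :\ k)%SET.

End ConditionalIndependence.

(* Main.v *)
(** Both claims are claims about separation in [G].

    Upward stability: let [k] be an ancestor of [j] and let a path from [i] to
    [j] connect given [C] together with [k].  Let [S] be the set of ancestors
    of [j] (including [j]) that are not ancestors of [C].  A collider outside
    [S] is an ancestor of [C].  Cutting the path at its first node in [S] and
    continuing along a directed path to [j], which stays in [S], therefore
    gives a path that connects given [C].

    Downward stability: a non-collider on a path has a tail at one of its two
    edges.  Following arrows from there leads to an endpoint or to a collider,
    so on a path that connects given [C :\ k] a non-collider is an ancestor of
    an endpoint or of [C :\ k], and [k] is not. *)
Require Import Defs.
From mathcomp Require Import all_boot all_order all_algebra.
From mathcomp Require Import all_classical all_reals all_analysis.

Set Implicit Arguments.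
Unset Strict Implicit.
Unset Printing Implicit Defensive.

(* MathComp-Analysis has its own [adjacent] and [separated]. *)
Import Defs.

(** * Connecting node sequences: cutting, gluing and reversal *)

Section Graph.
Variables (V : finType) (G : directed_ancestral_graph V).
Implicit Types (A B C : {set V}) (i j k x y : V) (s t p : seq V).

(** Reflexivity of [connect] merges the two alternatives of the collider condition: lying in [C] and
    being a proper ancestor of a node of [C]. *)
Definition ancestor_of_set C : pred V :=
  fun x => [exists c in C, connect (arrow G) x c].

Lemma ancestor_of_setP C x :
  reflect (x \in C \/ (exists2 c, c \in C & x \in an G c))
          (ancestor_of_set C x).
Proof.
apply: (iffP existsP) => [[c /andP[cC xc]]|[xC|[c cC]]].
- have [<-|nxc] := eqVneq c x; first by left.
  by right; exists c => //; rewrite inE eq_sym nxc.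
- by exists x; rewrite xC connect0.
- by rewrite inE => /andP[_ xc]; exists c; rewrite cC.
Qed.

Definition admissible C a k b : bool :=
  if collider G a k b then ancestor_of_set C k else k \notin C.

Lemma connectingE C s :
  connecting G C s <->
  forall s1 s2 a k b, s = s1 ++ [:: a, k, b & s2] -> admissible C a k b.
Proof.
rewrite /admissible; split=> cs s1 s2 a k b e; have := cs s1 s2 a k b e.
  by case: ifP => // _ /ancestor_of_setP.
by case: ifP => // _ /ancestor_of_setP.
Qed.

Lemma connecting_short C s : size s <= 2 -> connecting G C s.
Proof.
by move=> + s1 s2 a k b e; rewrite e size_cat /= addnC !addSn.
Qed.

Lemma connecting_cons3 C a k b s :
  connecting G C [:: a, k, b & s] <->
  admissible C a k b /\ connecting G C [:: k, b & s].
Proof.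
rewrite !connectingE; split=> [cs|[akb cs]].
  split; first exact: (cs [::] s).
  by move=> s1 s2 a' k' b' e; apply: (cs (a :: s1) s2); rewrite e.
by move=> [|x s1] s2 a' k' b' /= => [[<- <- <- _]|[_ /cs]].
Qed.

Lemma connecting_catr C p s : connecting G C (p ++ s) -> connecting G C s.
Proof.
by move=> cs s1 s2 a k b e; apply: (cs (p ++ s1) s2); rewrite e catA.
Qed.

Lemma connecting_catl C p s : connecting G C (p ++ s) -> connecting G C p.
Proof.
by move=> cs s1 s2 a k b e; apply: (cs s1 (s2 ++ s)); rewrite e -catA.
Qed.

(** The two sequences overlap in [a] and [y], so each triple of consecutive nodes of the glued
    sequence lies in one of them. *)
Lemma connecting_glue C p a y t :
  connecting G C (rcons p a ++ [:: y]) -> connecting G C [:: a, y & t] ->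
  connecting G C (rcons p a ++ y :: t).
Proof.
elim: p => [//|x [|x' p] IH] /=.
  by move=> /connecting_cons3[xay _] cs; apply/connecting_cons3.
case: p IH => [|x'' p] IH /connecting_cons3[ok cs] ct;
  by apply/connecting_cons3; split=> //; apply: IH.
Qed.

Lemma collider_sym a k b : collider G a k b = collider G b k a.
Proof. exact: andbC. Qed.

Lemma adjacent_sym : symmetric (adjacent G).
Proof. by move=> x y; rewrite /adjacent arc_sym orbCA. Qed.

Lemma connecting_rev C s : connecting G C s -> connecting G C (rev s).
Proof.
move=> cs s1 s2 a k b /(congr1 rev); rewrite revK rev_cat !rev_cons -!cats1.
by rewrite -!catA /= collider_sym; apply: cs.
Qed.

Lemma is_path_rev i s :
  is_path G i s -> is_path G (last i s) (rev (belast i s)).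
Proof.
move=> [ps us]; split; last by rewrite -rev_rcons -lastI rev_uniq.
by rewrite rev_path (eq_path (e' := adjacent G)) // => x y /=; rewrite adjacent_sym.
Qed.

Lemma separated_sym A B C : separated G A B C -> separated G B A C.
Proof.
move=> sep i s ps iB sA cs; apply: (sep _ _ (is_path_rev ps) sA).
  by case: s {ps sA cs} => [|x s] //=; rewrite rev_cons last_rcons.
by rewrite -rev_rcons -lastI; apply: connecting_rev.
Qed.

(** * Directed paths and upward stability *)

Lemma arrow_neq x y : arrow G x y -> x != y.
Proof.
apply: contraTneq => <-; apply/negP => xx.
by have /(_ [:: x]) := @no_directed_cycle _ G; rewrite /= xx => /(_ isT).
Qed.

Lemma arrow_tail x y : arrow G x y -> ~~ arrowhead_at G x y.
Proof.
move=> xy; have := at_most_one_edge G (arrow_neq xy).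
by rewrite xy /arrowhead_at arc_sym; case: (arrow G y x); case: (arc G y x).
Qed.

Lemma adjacent_tail x y : adjacent G x y -> ~~ arrowhead_at G x y -> arrow G x y.
Proof. by rewrite /adjacent /arrowhead_at arc_sym; case: (arrow G x y) => //= ->. Qed.

(** Each inner node has a tail on its outgoing arrow, so it is a non-collider, whatever edge joins
    [a] to [y]. *)
Lemma connecting_directed C a y t :
  path (arrow G) y t -> {in y :: t, forall x, x \notin C} ->
  connecting G C [:: a, y & t].
Proof.
elim: t a y => [|b t IH] a y /=; first by move=> _ _; apply: connecting_short.
move=> /andP[yb pt] nC; apply/connecting_cons3; split.
  rewrite /admissible /collider (negPf (arrow_tail yb)) andbF.
  by rewrite nC // mem_head.
by apply: IH => // x xt; apply: nC; rewrite inE xt orbT.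
Qed.

Lemma path_connect_last y t x :
  path (arrow G) y t -> x \in y :: t -> connect (arrow G) x (last y t).
Proof.
elim: t x y => [|z t IH] x y /=; first by move=> _; rewrite inE => /eqP->.
move=> /andP[yz pt]; rewrite inE => /predU1P[->|]; last exact: IH.
by apply: (connect_trans (connect1 yz)); apply: IH => //; rewrite mem_head.
Qed.

(** Adding [k] to the conditioning set can open a path only at colliders from which [k] is
    reachable. The final node [y] is an endpoint and never a collider, so only [p] is
    constrained. *)
Lemma connecting_weaken C k p y :
  connecting G (k |: C)%SET (rcons p y) ->
  {in p, forall x, connect (arrow G) x k -> ancestor_of_set C x} ->
  connecting G C (rcons p y).
Proof.
move=> /connectingE cs anC; apply/connectingE => s1 s2 a x b e.
have := cs _ _ _ _ _ e; rewrite /admissible; case: ifP => _; last first.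
  by rewrite !inE negb_or => /andP[].
move=> /existsP[c /andP[]]; rewrite !inE => /predU1P[->|cC] xc; last first.
  by apply/existsP; exists c; rewrite cC.
apply: anC => //.
have -> : p = s1 ++ [:: a, x & belast b s2].
  have := congr1 rev e; rewrite -cat_rcons -cat_rcons [b :: s2]lastI.
  rewrite -rcons_cat !rev_rcons => -[_ /(can_inj revK)->].
  by rewrite !cat_rcons.
by rewrite mem_cat !inE eqxx !orbT.
Qed.

Lemma separated_up i j k C :
  k \in an G j ->
  separated G [set i]%SET [set j]%SET C ->
  separated G [set i]%SET [set j]%SET (k |: C)%SET.
Proof.
rewrite inE => /andP[_ kj] sep i' s [ps us]; rewrite !inE => /eqP ii' /eqP sj cs.
subst i'.
pose S := [pred x | connect (arrow G) x j && ~~ ancestor_of_set C x].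
have notS x : x \notin S -> connect (arrow G) x k -> ancestor_of_set C x.
  by rewrite inE negb_and negbK => /orP[|//] + xk; rewrite (connect_trans xk kj).
have [hasS|] := boolP (has S (i :: s)); last first.
  move=> /hasPn noS; apply: (sep i s); rewrite ?inE ?sj //.
  rewrite lastI; apply: (connecting_weaken (k := k)); rewrite -?lastI // => x xs.
  by apply/notS/noS; rewrite lastI mem_rcons inE xs orbT.
have [p [y [s2 [Sy noS ep]]]] : exists p y s2,
    [/\ y \in S, ~~ has S p & i :: s = p ++ y :: s2].
  case: (split_find hasS) => y p s2 Sy noS.
  by exists p, y, s2; rewrite cat_rcons.
have /andP[yj nCy] : y \in S := Sy.
have [t [pt ut tj]] :
    exists t, [/\ path (arrow G) y t, uniq (y :: t) & last y t = j].
  have /connectP[t' pt' ->] := yj.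
  by case: (shortenP pt') => t pt ut _; exists t.
(* An ancestor of [C] among these nodes would make [y] one too. *)
have St : {in y :: t, forall x, x \in S}.
  move=> x xt; rewrite inE -tj (path_connect_last pt xt) /=.
  apply: contra nCy => /existsP[c /andP[cC xc]]; apply/existsP; exists c.
  by rewrite cC (connect_trans (path_connect pt xt) xc).
have tC : {in y :: t, forall x, x \notin C}.
  move=> x /St /andP[_]; apply: contra => xC.
  by apply/ancestor_of_setP; left.
have pt' : path (adjacent G) y t.
  by apply: sub_path pt => a b ab; rewrite /adjacent ab.
(* The directed path lies in [S] and [p] avoids [S], so no node repeats. *)
have upt : uniq (p ++ y :: t).
  move: us; rewrite ep !cat_uniq => /and3P[-> _ _]; rewrite ut andbT.
  apply/hasPn => x /St Sx; apply: contra noS => xp.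
  by apply/hasP; exists x.
have cpy : connecting G C (rcons p y).
  apply: (connecting_weaken (k := k)).
    by move: cs; rewrite ep -cat_rcons => /connecting_catl.
  by move=> x xp; apply: notS; apply: contra noS => Sx; apply/hasP; exists x.
(* If [p] is empty, then [y] is [i] and the directed path alone contradicts separation; [i] then
   serves as its own dummy predecessor in [connecting_directed]. *)
case: p ep noS upt cpy => [[ei _] _ ut' _|i' p [<- es] _ upt cpy].
  rewrite -ei in ut' pt' pt tj tC; apply: (sep i t); rewrite ?inE ?tj //.
  by apply: (connecting_catr (p := [:: i])); apply: connecting_directed.
apply: (sep i (p ++ y :: t)); rewrite ?inE ?last_cat //= ?tj //.
  split=> //; move: ps; rewrite es !cat_path /= => /and3P[-> -> _].
  exact: pt'.
rewrite -cat_cons lastI; apply: connecting_glue.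
  by rewrite -lastI cats1.
exact: connecting_directed.
Qed.

(** * Downward stability *)

Lemma tail_ancestor C k b s :
  path (adjacent G) b s -> arrow G k b -> connecting G C [:: k, b & s] ->
  connect (arrow G) k (last b s) \/ ancestor_of_set C k.
Proof.
elim: s k b => [|b' s IH] k b /=; first by left; apply: connect1.
move=> /andP[bb' ps] kb /connecting_cons3[ok cs].
(* An arrowhead at [b] makes [b] a collider, hence an ancestor of [C]; a tail gives an arrow out of
   [b], and the induction continues. *)
have [bb'h|/(adjacent_tail bb') bb'a] := boolP (arrowhead_at G b b').
  right; move: ok; rewrite /admissible /collider bb'h /arrowhead_at kb /=.
  move=> /existsP[c /andP[cC bc]]; apply/existsP; exists c.
  by rewrite cC (connect_trans (connect1 kb)).
case: (IH _ _ ps bb'a cs) => [bl|/existsP[c /andP[cC bc]]].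
  by left; apply: connect_trans (connect1 kb) bl.
by right; apply/existsP; exists c; rewrite cC (connect_trans (connect1 kb)).
Qed.

Lemma noncollider_ancestor C i s s1 s2 a k b :
  is_path G i s -> connecting G C (i :: s) ->
  i :: s = s1 ++ [:: a, k, b & s2] -> ~~ collider G a k b ->
  [|| k \in an G i, k \in an G (last i s) | ancestor_of_set C k].
Proof.
(* This handles a tail at [k] on the edge to its successor; a tail on the other edge is reduced to
   it by reversing the path. *)
have follow i' s' r1 r2 a' b' : is_path G i' s' -> connecting G C (i' :: s') ->
    i' :: s' = r1 ++ [:: a', k, b' & r2] -> ~~ arrowhead_at G k b' ->
    (k \in an G (last i' s')) || ancestor_of_set C k.
  move=> [ps us] cs e tl.
  have ls : last i' s' = last b' r2.
    by have := congr1 (last i') e; rewrite last_cat.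
  have := us; rewrite e cat_uniq /= => /and5P[_ _ _ kn _].
  have := ps; rewrite -[path _ _ _]/(sorted _ (i' :: s')) e.
  move=> /cat_sorted2[_ /= /and3P[_ kb' pr]].
  rewrite e -cat_rcons in cs.
  case: (tail_ancestor pr (adjacent_tail kb' tl) (connecting_catr cs)) => [kl|->].
    rewrite ls inE kl andbT; apply/orP; left.
    (* Nodes of a path are distinct, so [k] is a proper ancestor of the endpoint. *)
    by apply: contraNneq kn => ->; rewrite mem_last.
  by rewrite orbT.
move=> ps cs e; rewrite negb_and => /orP[tl|tl]; last first.
  by case/orP: (follow _ _ _ _ _ _ ps cs e tl) => ->; rewrite ?orbT.
have er : last i s :: rev (belast i s) = rev s2 ++ [:: b, k, a & rev s1].
  by rewrite -rev_rcons -lastI e rev_cat !rev_cons -!cats1 -!catA.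
have crev : connecting G C (last i s :: rev (belast i s)).
  by rewrite -rev_rcons -lastI; apply: connecting_rev.
have := follow _ _ _ _ _ _ (is_path_rev ps) crev er tl.
have -> : last (last i s) (rev (belast i s)) = i.
  by case: (s) => [|x s'] //=; rewrite rev_cons last_rcons.
by case/orP=> ->; rewrite ?orbT.
Qed.

Lemma separated_down i j k C :
  k != i -> k != j -> k \notin an G i -> k \notin an G j ->
  {in C :\ k, forall l, k \notin an G l}%SET ->
  separated G [set i]%SET [set j]%SET C ->
  separated G [set i]%SET [set j]%SET (C :\ k)%SET.
Proof.
move=> ki kj kai kaj kaC sep i' s ps; rewrite !inE => /eqP ii' /eqP sj cs.
subst i'; apply: (sep i s); rewrite ?inE ?sj //.
apply/connectingE => s1 s2 a x b e.
have /connectingE/(_ _ _ _ _ _ e) := cs.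
rewrite /admissible; case: ifP => [_ /existsP[c /andP[/setD1P[_ cC] xc]]|ncol].
  by apply/existsP; exists c; rewrite cC.
(* Among non-colliders, only [k] itself can be outside [C :\ k] and inside [C]; the ancestor
   hypotheses exclude this case. *)
rewrite !inE negb_and negbK => /orP[/eqP xk|//].
have := noncollider_ancestor ps cs e (negbT ncol).
rewrite xk sj (negPf kai) (negPf kaj) /= => /ancestor_of_setP[|[c /kaC]].
  by rewrite !inE eqxx.
by move=> /negPf->.
Qed.

End Graph.

(** * Transfer to conditional independence *)

Lemma disjoint_tripleE (V : finType) (i j : V) (C : {set V}) :
  disjoint_triple [set i]%SET [set j]%SET C =
  [&& i != j, i \notin C & j \notin C].
Proof. by rewrite /disjoint_triple !disjoints1 !inE. Qed.

Theorem proposition11 (V : finType) (G0 : directed_ancestral_graph V)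
    (R : realType) (d : measure_display) (Omega : measurableType d)
    (P : probability Omega R) (dE : V -> measure_display)
    (E : forall v : V, measurableType (dE v))
    (X : forall v : V, {RV P >-> E v}) :
  faithful X G0 ->
  forall G : directed_ancestral_graph V, Markov_equivalent G G0 ->
    ordered_upward_stable X (minimal_order G) /\
    ordered_downward_stable X (minimal_order G).
Proof.
move=> fX G; rewrite /Markov_equivalent -fX => JG.
(* Faithfulness to [G0] and Markov equivalence identify independence under [P] with separation in
   [G]. *)
have indepE i j (C : {set V}) : i != j -> i \notin C -> j \notin C ->
    cond_indep X [set i]%SET [set j]%SET C <->
    separated G [set i]%SET [set j]%SET C.
  move=> ij iC jC.
  have dis : disjoint_triple [set i]%SET [set j]%SET C.
    by rewrite disjoint_tripleE ij iC.
  have := congr1 (fun J => J ([set i]%SET, [set j]%SET, C)) JG.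
  rewrite /J_graph /J_dist /= => eqJ.
  by split=> h; [have : _ /\ _ := conj dis h; rewrite -eqJ => -[]
                |have : _ /\ _ := conj dis h; rewrite eqJ => -[]].
split=> i j C ij iC jC /(indepE _ _ _ ij iC jC) sep k ki kj.
- move=> lt_k; apply/indepE; rewrite ?inE ?negb_or ?(eq_sym _ k) ?ki ?kj //.
  case/orP: lt_k => [kai|]; last by move=> kaj; apply: separated_up.
  (* An ancestor of [i] is handled by exchanging the two endpoints. *)
  by apply/separated_sym/separated_up/separated_sym.
- move=> kai kaj kaC; apply/indepE; rewrite ?inE ?negb_and ?iC ?jC ?orbT //.
  exact: separated_down.
Qed.
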